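(* Let $\varphi$ be a comparison function and let $\mathcal{F}=((X,d),(f_i)_{i\in I})$ be a generalized possibly infinite iterated function system of order $m\in\mathbb{N}^*$ such that all the functions $f_i$, $i\in I$, are $\varphi$-contractions. Then the operator $H_{\mathcal{F}}:\mathcal{C}^m\to\mathcal{C}$ is a $\varphi$-contraction.
   Context: $\mathbb{N}^{*}=\{1,2,\dots\}$. The sets $X$ and $I$ are nonempty. For a metric space $(Y,\rho)$ and $m\in\mathbb{N}^*$, $Y^m$ carries the maximum metric $\rho_{\max}((x_1,\dots,x_m),(y_1,\dots,y_m))=\max_j \rho(x_j,y_j)$. A comparison function is a map $\varphi:[0,\infty)\to[0,\infty)$ that is nondecreasing, right-continuous, and satisfies $\varphi(t)<t$ for all $t>0$. A map $f:Y^m\to Y$ on a metric space $(Y,\rho)$ is a $\varphi$-contraction if $\rho(f(x),f(y))\le\varphi(\rho_{\max}(x,y))$ for all $x,y\in Y^m$. A generalized possibly infinite iterated function system of order $m$ is a pair $\mathcal{F}=((X,d),(f_i)_{i\in I})$, where $(X,d)$ is a metric space, each $f_i:X^m\to X$ is continuous, and the family $(f_i)_{i\in I}$ is bounded, i.e. $\bigcup_{i\in I}f_i(B)$ is bounded for every bounded $B\subseteq X^m$. Code space: $\Omega_1=I$, $\Omega_{k+1}=\Omega_k\times\dots\times\Omega_k$ ($m$ times), and $\Omega=\Omega_1\times\Omega_2\times\cdots$. Elements of $\Omega$ are written $\alpha=\alpha^1\alpha^2\dots\alpha^k\dots$ with $\alpha^k\in\Omega_k$; for $k\ge2$ write $\alpha^k=\alpha^k_1\alpha^k_2\dots\alpha^k_m$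 with $\alpha^k_i\in\Omega_{k-1}$, and for $i\in\{1,\dots,m\}$ put $\alpha(i)=\alpha^2_i\alpha^3_i\alpha^4_i\dots\in\Omega$. $\Omega$ is endowed with the metric $d(\alpha,\beta)=\sum_{k\ge1}c^k\,\delta(\alpha^k,\beta^k)$, where $c\in(0,1)$ is fixed and $\delta(\alpha^k,\beta^k)$ is $1$ if $\alpha^k\neq\beta^k$ and $0$ otherwise. $\mathcal{C}$ is the set of continuous bounded functions $f:\Omega\to X$ with the metric $d_u(f,g)=\sup_{\alpha\in\Omega}d(f(\alpha),g(\alpha))$; $\mathcal{C}^m$ carries the corresponding maximum metric. The operator $H_{\mathcal{F}}:\mathcal{C}^m\to\mathcal{C}$ is $H_{\mathcal{F}}(g_1,\dots,g_m)(\alpha)=f_{\alpha^1}(g_1(\alpha(1)),\dots,g_m(\alpha(m)))$ for $\alpha=\alpha^1\alpha^2\dots\in\Omega$. *)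

(* Defs.v *)
From HB Require Import structures.
From mathcomp Require Import all_boot all_order all_algebra.
From mathcomp Require Import all_classical all_reals.
From mathcomp Require Import topology normedtype sequences.

Set Implicit Arguments.
Unset Strict Implicit.
Unset Printing Implicit Defensive.

Import Order.TTheory GRing.Theory Num.Theory.
Import numFieldNormedType.Exports.

Local Open Scope classical_set_scope.
Local Open Scope ring_scope.

(* This power Y^m is a new name for ['I_m -> Y] so that it carries the
   maximum metric rather than the library's product topology on functions. *)
Definition npow (m : nat) (Y : Type) : Type := 'I_m -> Y.

HB.instance Definition _ (m : nat) (Y : Type) := gen_eqMixin (npow m Y).
HB.instance Definition _ (m : nat) (Y : Type) := gen_choiceMixin (npow m Y).

Section MaxMetric.
Variables (R : realType) (m : nat) (Y : metricType R).
Implicit Types x y z : npow m Y.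

Definition max_dist x y : R := \big[Num.max/0]_(j < m) mdist (x j) (y j).

Lemma max_distxx x : max_dist x x = 0.
Proof.
rewrite /max_dist (eq_bigr (fun=> 0)); last by move=> j _; rewrite mdistxx.
by apply/le_anti; rewrite bigmax_le//= bigmax_ge_id.
Qed.

Lemma mdist_le_max_dist x y j : mdist (x j) (y j) <= max_dist x y.
Proof. exact: (le_bigmax _ (fun j => mdist (x j) (y j))). Qed.

Lemma max_dist_positivity x y : max_dist x y = 0 -> x = y.
Proof.
move=> xy; apply/funext => j; apply: mdist_positivity; apply/le_anti.
by rewrite mdist_ge0 -xy mdist_le_max_dist.
Qed.

Lemma max_dist_sym x y : max_dist x y = max_dist y x.
Proof. by apply: eq_bigr => j _; rewrite metric_sym. Qed.

Lemma max_dist_triangle y x z : max_dist x z <= max_dist x y + max_dist y z.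
Proof.
apply: bigmax_le => [|j _]; first by rewrite addr_ge0// bigmax_ge_id.
apply: le_trans (metric_triangle _ (y j) _) _.
by apply: lerD; exact: mdist_le_max_dist.
Qed.

HB.instance Definition _ := isMetric.Build R (npow m Y)
  max_distxx max_dist_positivity max_dist_sym max_dist_triangle.

End MaxMetric.

(* The set Omega_(k+1): levels are numbered from 0 here. *)
Fixpoint code_level (I : Type) (m k : nat) : Type :=
  if k is k'.+1 then npow m (code_level I m k') else I.

(* The code space Omega; [a k] is the letter alpha^(k+1). The proof [c01] only
   selects the parameter c of the metric. *)
Definition code_space (R : realType) (c : R) (c01 : 0 < c < 1)
  (I : Type) (m : nat) : Type := forall k, code_level I m k.

HB.instance Definition _ (R : realType) (c : R) (c01 : 0 < c < 1)
  (I : Type) (m : nat) := gen_eqMixin (code_space c01 I m).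
HB.instance Definition _ (R : realType) (c : R) (c01 : 0 < c < 1)
  (I : Type) (m : nat) := gen_choiceMixin (code_space c01 I m).

Section CodeMetric.
Variables (R : realType) (c : R) (c01 : 0 < c < 1) (I : Type) (m : nat).
Local Notation Omega := (code_space c01 I m).
Implicit Types a b : Omega.

Definition code_dist_term a b (k : nat) : R :=
  c ^+ k.+1 * (`[< a k <> b k >])%:R.

Definition code_dist a b : R := limn (series (code_dist_term a b)).

Let c0 : 0 < c. Proof. by case/andP: c01. Qed.

Lemma code_dist_term_ge0 a b k : 0 <= code_dist_term a b k.
Proof. by rewrite mulr_ge0// exprn_ge0// ltW. Qed.

Lemma is_cvg_code_dist a b : cvgn (series (code_dist_term a b)).
Proof.
apply: (@series_le_cvg _ _ (geometric c c)) => [k|k|k|].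
- exact: code_dist_term_ge0.
- by rewrite /= mulr_ge0 ?exprn_ge0 ?ltW.
- rewrite /code_dist_term /= exprS; apply: ler_piMr; last first.
    by case: `[< _ >]; rewrite ?lexx ?ler01.
  by rewrite mulr_ge0 ?exprn_ge0 ?ltW.
- by apply: is_cvg_geometric_series; rewrite gtr0_norm//; case/andP: c01.
Qed.

Lemma code_dist_term_le a b k : code_dist_term a b k <= code_dist a b.
Proof.
apply: (@le_trans _ _ (series (code_dist_term a b) k.+1)).
  rewrite /series /= big_nat_recr//= lerDr.
  by apply: sumr_ge0 => i _; exact: code_dist_term_ge0.
apply: nondecreasing_cvgn_le; last exact: is_cvg_code_dist.
apply/nondecreasing_seqP => n; rewrite /series /= big_nat_recr//= lerDl.
exact: code_dist_term_ge0.
Qed.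

Lemma code_distxx a : code_dist a a = 0.
Proof.
rewrite /code_dist (_ : series _ = cst 0) ?lim_cst//.
apply/funext => n; rewrite /series /= big1// => k _.
by rewrite /code_dist_term (_ : `[< _ >] = false) ?mulr0//; exact/asboolP.
Qed.

Lemma code_dist_lt a b k : code_dist a b < c ^+ k.+1 -> a k = b k.
Proof.
move=> ab; apply: contrapT => akb.
have := le_lt_trans (code_dist_term_le a b k) ab.
by rewrite /code_dist_term (_ : `[< _ >] = true) ?mulr1 ?ltxx//; exact/asboolP.
Qed.

Lemma code_dist_positivity a b : code_dist a b = 0 -> a = b.
Proof.
move=> ab; apply: functional_extensionality_dep => k; apply: code_dist_lt.
by rewrite ab exprn_gt0.
Qed.

Lemma code_dist_sym a b : code_dist a b = code_dist b a.
Proof.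
rewrite /code_dist; congr (limn (series _)); apply/funext => k.
rewrite /code_dist_term; congr (_ * (nat_of_bool _)%:R).
by apply: asbool_equiv_eq; split=> + /esym.
Qed.

Lemma code_dist_triangle b a d : code_dist a d <= code_dist a b + code_dist b d.
Proof.
rewrite /code_dist -lim_seriesD; [|exact: is_cvg_code_dist..].
apply: lim_series_le; first exact: is_cvg_code_dist.
  by apply: is_cvg_seriesD; exact: is_cvg_code_dist.
move=> k; rewrite /code_dist_term /= -mulrDr; apply: ler_wpM2l.
  by rewrite exprn_ge0// ltW.
change (`[< a k <> d k >]%:R <= `[< a k <> b k >]%:R + `[< b k <> d k >]%:R :> R).
rewrite -natrD ler_nat; case: asboolP => //= ad.
case: asboolP => //= /contrapT ab; case: asboolP => //= /contrapT bd.
by case: ad; rewrite ab.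
Qed.

HB.instance Definition _ := isMetric.Build R Omega
  code_distxx code_dist_positivity code_dist_sym code_dist_triangle.

(* The code alpha(i), obtained by keeping the i-th component of each letter
   alpha^2, alpha^3, and so on. *)
Definition code_shift (i : 'I_m) (a : Omega) : Omega := fun k => a k.+1 i.

Lemma code_dist_shift i a b :
  code_dist (code_shift i a) (code_shift i b) <= c^-1 * code_dist a b.
Proof.
have cs n : series (code_dist_term (code_shift i a) (code_shift i b)) n
    <= c^-1 * code_dist a b.
  rewrite ler_pdivlMl//.
  apply: (@le_trans _ _ (series (code_dist_term a b) n.+1)).
    rewrite /series /= big_nat_recl// mulr_sumr.
    rewrite -[leLHS]add0r lerD ?code_dist_term_ge0//; apply: ler_sum => k _.
    rewrite /code_dist_term mulrA -exprS; apply: ler_wpM2l.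
      by rewrite exprn_ge0// ltW.
    rewrite ler_nat /code_shift; case: asboolP => //= shiftN.
    by case: asboolP => //= /contrapT E; case: shiftN; rewrite E.
  apply: nondecreasing_cvgn_le; last exact: is_cvg_code_dist.
  apply/nondecreasing_seqP => p; rewrite /series /= [leRHS]big_nat_recr//= lerDl.
  exact: code_dist_term_ge0.
apply: limr_le; first exact: is_cvg_code_dist.
by near=> n; exact: cs.
Unshelve. all: by end_near.
Qed.

Lemma continuous_code_shift i : continuous (code_shift i : Omega -> Omega).
Proof.
move=> a; apply/(@metricType_numDomainType.cvgrPdist_lt _ _ _ (nbhs a)) => e e0.
apply/(@metricType_numDomainType.nbhs_mdistP _ Omega a); exists (c * e) => /=; first exact: mulr_gt0.
move=> b /= ab; apply: le_lt_trans (code_dist_shift i a b) _.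
by rewrite ltr_pdivrMl.
Qed.

Lemma near_code_head (a : Omega) : \forall b \near a, a 0%N = b 0%N.
Proof.
apply/(@metricType_numDomainType.nbhs_mdistP _ Omega a); exists c => [|b /= ab]; first exact: c0.
by apply: (@code_dist_lt a b 0); rewrite expr1.
Qed.

End CodeMetric.

Definition metric_bounded (R : realType) (Y : metricType R) (B : set Y) : Prop :=
  exists M : R, forall x y, B x -> B y -> mdist x y <= M.

Record cbfun (R : realType) (T : topologicalType) (X : metricType R) := CBFun {
  cbfun_fun :> T -> X;
  cbfun_continuous : continuous cbfun_fun;
  cbfun_bounded : metric_bounded (range cbfun_fun) }.

HB.instance Definition _ (R : realType) (T : topologicalType)
  (X : metricType R) := gen_eqMixin (cbfun T X).
HB.instance Definition _ (R : realType) (T : topologicalType)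
  (X : metricType R) := gen_choiceMixin (cbfun T X).

Section UniformMetric.
Variables (R : realType) (T : topologicalType) (X : metricType R).
Implicit Types f g h : cbfun T X.

Definition unif_dist f g : R := sup (range (fun t => mdist (f t) (g t))).

Lemma cbfun_eq f g : f =1 g -> f = g.
Proof.
case: f g => [f cf bf] [g cg bg] /= /funext fg.
move: cg bg; rewrite -fg => cg bg.
exact: (f_equal2 (CBFun (cbfun_fun := f)) (Prop_irrelevance cf cg)
  (Prop_irrelevance bf bg)).
Qed.

Lemma has_ubound_unif_dist f g :
  has_ubound (range (fun t => mdist (f t) (g t))).
Proof.
have [[t0]|T0] := pselect (inhabited T); last first.
  by exists 0 => y [t]; case: T0; exists.
have [[M fM] [N gN]] := (cbfun_bounded f, cbfun_bounded g).
exists (M + mdist (f t0) (g t0) + N) => _ [t _ <-].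
apply: le_trans (metric_triangle _ (g t0) _) _.
apply: lerD; last by apply: gN; [exists t0|exists t].
apply: le_trans (metric_triangle _ (f t0) _) _.
by rewrite lerD2r; apply: fM; [exists t|exists t0].
Qed.

Lemma mdist_le_unif_dist f g t : mdist (f t) (g t) <= unif_dist f g.
Proof. by apply: ub_le_sup; [exact: has_ubound_unif_dist|exists t]. Qed.

Lemma unif_dist_empty f g : ~ inhabited T -> unif_dist f g = 0.
Proof.
move=> T0; rewrite /unif_dist.
have -> : range (fun t => mdist (f t) (g t)) = set0; last exact: sup0.
by rewrite -subset0 => y [t]; case: T0; exists.
Qed.

Lemma unif_dist_le f g (M : R) :
  0 <= M -> (forall t, mdist (f t) (g t) <= M) -> unif_dist f g <= M.
Proof.
move=> M0 fgM; have [[t0]|T0] := pselect (inhabited T).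
  by apply: ge_sup; [exists (mdist (f t0) (g t0)), t0|move=> _ [t _ <-]].
by rewrite unif_dist_empty.
Qed.

Lemma unif_dist_ge0 f g : 0 <= unif_dist f g.
Proof.
have [[t]|T0] := pselect (inhabited T).
  exact: le_trans (mdist_ge0 _ _) (mdist_le_unif_dist f g t).
by rewrite unif_dist_empty.
Qed.

Lemma unif_distxx f : unif_dist f f = 0.
Proof.
apply/le_anti; rewrite unif_dist_ge0 andbT.
by apply: unif_dist_le => // t; rewrite mdistxx.
Qed.

Lemma unif_dist_positivity f g : unif_dist f g = 0 -> f = g.
Proof.
move=> fg; apply: cbfun_eq => t; apply: mdist_positivity; apply/le_anti.
by rewrite mdist_ge0 -fg mdist_le_unif_dist.
Qed.

Lemma unif_dist_sym f g : unif_dist f g = unif_dist g f.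
Proof.
rewrite /unif_dist.
by under eq_fun do rewrite metric_sym.
Qed.

Lemma unif_dist_triangle g f h : unif_dist f h <= unif_dist f g + unif_dist g h.
Proof.
apply: unif_dist_le => [|t]; first by rewrite addr_ge0 ?unif_dist_ge0.
apply: le_trans (metric_triangle _ (g t) _) _.
by apply: lerD; exact: mdist_le_unif_dist.
Qed.

HB.instance Definition _ := isMetric.Build R (cbfun T X)
  unif_distxx unif_dist_positivity unif_dist_sym unif_dist_triangle.

End UniformMetric.

(* A comparison function is given by a total function on R, of which only the
   restriction to the nonnegative reals is constrained or used. *)
Definition comparison_function (R : realType) (phi : R -> R) : Prop :=
  [/\ forall t, 0 <= t -> 0 <= phi t,
      forall s t, 0 <= s -> s <= t -> phi s <= phi t,
      forall t, 0 <= t -> phi s @[s --> t^'+] --> phi t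
    & forall t, 0 < t -> phi t < t].

Definition phi_contraction (R : realType) (m : nat) (Y : metricType R)
  (phi : R -> R) (f : npow m Y -> Y) : Prop :=
  forall x y : npow m Y, mdist (f x) (f y) <= phi (mdist x y).

Record gifs (R : realType) (m : nat) (X : metricType R) (I : Type) := Gifs {
  gifs_fun :> I -> npow m X -> X;
  gifs_continuous : forall i, continuous (gifs_fun i);
  gifs_bounded : forall B : set (npow m X), metric_bounded B ->
    metric_bounded (\bigcup_i (gifs_fun i @` B)) }.

Section Operator.
Variables (R : realType) (c : R) (c01 : 0 < c < 1) (I : Type) (m : nat).
Variables (X : metricType R) (F : gifs m X I).
Local Notation Omega := (code_space c01 I m).
Local Notation C := (cbfun Omega X).

Definition gifs_op_fun (g : npow m C) (a : Omega) : X :=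
  F (a 0%N) (fun j => g j (code_shift j a)).

Lemma gifs_op_continuous (g : npow m C) : continuous (gifs_op_fun g).
Proof.
move=> a; apply/(@metricType_numDomainType.cvgrPdist_lt _ _ _ (nbhs a)) => e e0.
have /metricType_numDomainType.cvgrPdist_lt/(_ _ e0) :=
  @gifs_continuous _ _ _ _ F (a 0%N) (fun j => g j (code_shift j a)).
move=> /metricType_numDomainType.nbhs_mdistP[d /= d0 dF].
have gd : \forall b \near a, forall j : 'I_m,
    mdist (g j (code_shift j a)) (g j (code_shift j b)) < d.
  apply: (@filter_forall _ _ (fun j b => mdist (g j (code_shift j a))
    (g j (code_shift j b)) < d) (nbhs a) (nbhs_filter a)) => j.
  have : {for a, continuous (g j \o code_shift j : Omega -> X)}.
    apply: continuous_comp; first exact: continuous_code_shift.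
    exact: cbfun_continuous.
  by move=> /metricType_numDomainType.cvgrPdist_lt/(_ _ d0).
near=> b; rewrite /gifs_op_fun.
have <- : a 0%N = b 0%N by near: b; exact: near_code_head.
apply: dF; rewrite /mdist /= /max_dist; apply: bigmax_lt => // j _.
by move: j; near: b.
Unshelve. all: by end_near.
Qed.

Lemma gifs_op_bounded (g : npow m C) : metric_bounded (range (gifs_op_fun g)).
Proof.
pose B := [set x : npow m X | forall j, range (g j) (x j)].
have [|M BM] := @gifs_bounded _ _ _ _ F B.
  have /choice[M gM] : forall j, exists M : R, forall x y,
    range (g j) x -> range (g j) y -> mdist x y <= M.
    by move=> j; exact: cbfun_bounded.
  exists (\big[Num.max/0]_(j < m) M j) => x y Bx By.
  apply: le_bigmax2 => j _; exact: gM.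
exists M => _ _ [a _ <-] [b _ <-]; apply: BM.
  by exists (a 0%N) => //; exists (fun j => g j (code_shift j a)) => // j;
    exists (code_shift j a).
by exists (b 0%N) => //; exists (fun j => g j (code_shift j b)) => // j;
  exists (code_shift j b).
Qed.

Definition gifs_op (g : npow m C) : C :=
  CBFun (@gifs_op_continuous g) (gifs_op_bounded g).

End Operator.

Arguments gifs_op {R c} c01 {I m X} F g.

(* Main.v *)
Require Import Defs.
From mathcomp Require Import all_boot all_order all_algebra.
From mathcomp Require Import all_classical all_reals.
From mathcomp Require Import topology normedtype sequences.

Import Order.TTheory GRing.Theory Num.Theory.
Local Open Scope ring_scope.

(** Evaluating the operator at a code [a] applies the single map [F (a 0)] to
    the tuple of values of the [g j] at the shifted codes. The two tuples so
    obtained from [g] and [h] are at distance at most the distance from [g] to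
    [h], because in each coordinate the uniform distance bounds the distance
    of values at one code. Since every [F i] is a contraction for the same
    [phi] and [phi] is nondecreasing, the bound [phi (mdist g h)] is uniform in
    [a], so it passes to the supremum. *)

(** The uniform and maximum metrics are both suprema, so evaluation of a tuple
    of functions is 1-Lipschitz even when each function is evaluated at its own
    point; the operator needs this freedom since its [j]-th function is taken
    at the [j]-th shift of the code. *)
Lemma mdist_eval_le (R : realType) (T : topologicalType) (X : metricType R)
  (m : nat) (g h : npow m (cbfun T X)) (t : 'I_m -> T) :
  mdist ((fun j => g j (t j)) : npow m X) (fun j => h j (t j)) <= mdist g h.
Proof. by apply: le_bigmax2 => j _; exact: mdist_le_unif_dist. Qed.

Theorem proposition3p3 (R : realType) (X : metricType R) (I : Type)
  (m : nat) (c : R) (c01 : 0 < c < 1)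
  (F : gifs m X I) (phi : R -> R) :
  inhabited X -> inhabited I -> (0 < m)%N ->
  comparison_function phi ->
  (forall i : I, phi_contraction phi (F i)) ->
  phi_contraction phi (gifs_op c01 F).
Proof.
move=> _ _ _ [phi_ge0 phi_nd _ _] Fphi g h.
apply: unif_dist_le => [|a]; first exact/phi_ge0/mdist_ge0.
apply: le_trans (Fphi (a 0%N) _ _) _.
by apply: phi_nd; [exact: mdist_ge0|exact: mdist_eval_le].
Qed.
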